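(* Let $\mathcal{M}$ be a reversible Markov chain on a state space $\Sigma$ with stationary distribution $\pi$ and label function $\omega:\Sigma\to\mathbb{R}$. Let $k\ge 0$ and $m\ge 1$ be integers, let $\varepsilon>0$ and $\alpha>0$ be real numbers, and let $\sigma_0\in\Sigma$ be a fixed state. Consider $m$ independent trajectories $\mathcal{T}^i=(X^i_0,X^i_1,\dots,X^i_k)$, $i=1,\dots,m$, of $\mathcal{M}$ from the common starting point $X^1_0=\dots=X^m_0=\sigma_0$. If $\sigma_0$ is not an $(\varepsilon,\alpha)$-outlier in $\mathcal{M}$ with respect to $k$, then $$\Pr\big(\text{for every } i\in\{1,\dots,m\},\ \omega(\sigma_0)\text{ is an }\varepsilon\text{-outlier among }\omega(X^i_0),\dots,\omega(X^i_k)\big)\le\left(\frac{2\varepsilon}{\alpha}\right)^{m/2}.$$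
   Context: Markov chains are time-homogeneous, discrete-time, on a discrete (finite or countable) state space $\Sigma$, specified by transition probabilities $P(\sigma,\tau)$. A trajectory of $\mathcal{M}$ from $\sigma_0$ is a sequence $X_0=\sigma_0,X_1,X_2,\dots$ of random variables with $\Pr(X_i=\sigma_i\mid X_{i-1}=\sigma_{i-1},\dots,X_0=\sigma_0)=P(\sigma_{i-1},\sigma_i)$. A trajectory is $\pi$-stationary if $X_0\sim\pi$, where $\pi$ is a stationary distribution. $\mathcal{M}$ is reversible (with respect to $\pi$) if every $\pi$-stationary trajectory $X_0,\dots,X_k$ has the same distribution as its reverse $X_k,\dots,X_0$. A real number $a_0$ is an $\varepsilon$-outlier among $a_0,\dots,a_k$ if $\#\{i\in\{0,\dots,k\}: a_i\le a_0\}\le \varepsilon(k+1)$. For $\sigma\in\Sigma$, let $p^k_{0,\varepsilon}(\sigma)$ be the probability that, on a trajectory $\sigma=X_0,X_1,\dots,X_k$ of $\mathcal{M}$ started at $\sigma$, $\omega(\sigma)$ is an $\varepsilon$-outlier among $\omega(X_0),\dots,\omega(X_k)$. With respect to $k$, the state $\sigma_0$ is an $(\varepsilon,\alpha)$-outlier in $\mathcal{M}$ if $p^k_{0,\varepsilon}(\sigma_0)$ is in the largest $\alpha$ fraction of the values $p^k_{0,\varepsilon}(\sigma)$ over all states $\sigma\in\Sigma$, weighted according to $\pi$; that is, if $\Pr_{\sigma\sim\pi}\big(p^k_{0,\varepsilon}(\sigma)\ge p^k_{0,\varepsilon}(\sigma_0)\big)\le\alpha$. *)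

(* Defs.v *)
From HB Require Import structures.
From mathcomp Require Import all_boot all_order all_algebra.
From mathcomp Require Import all_classical all_reals all_analysis.

Set Implicit Arguments.
Unset Strict Implicit.
Unset Printing Implicit Defensive.

Import Order.TTheory GRing.Theory Num.Theory.
Import numFieldNormedType.Exports.

Local Open Scope classical_set_scope.
Local Open Scope ring_scope.

(* Finite and countably infinite state spaces are both covered by countType;
   such a space carries the discrete sigma-algebra, and since it is countable,
   measurability of a map into it amounts to measurability of its fibres. *)
Definition discrete_rv d (T : measurableType d) (S : countType) (Y : T -> S) :=
  forall s : S, measurable (Y @^-1` [set s]).

Definition is_pmf (R : realType) (S : countType) (p : S -> R) :=
  (forall s, 0 <= p s) /\ (\esum_(s in [set: S]) (p s)%:E = 1)%E.

Record markov_chain (R : realType) (S : countType) := MarkovChain {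
  trans :> S -> S -> R ;
  trans_pmf : forall s, is_pmf (trans s) }.

Definition stationary (R : realType) (S : countType) (M : markov_chain R S)
    (pi : S -> R) :=
  is_pmf pi /\
  forall t, (\esum_(s in [set: S]) (pi s * M s t)%:E = (pi t)%:E)%E.

Definition cond_prob d (T : measurableType d) (R : realType)
    (Pr : probability T R) (A B : set T) : R :=
  fine (Pr (A `&` B)) / fine (Pr B).

(* A trajectory X_0, ..., X_k is given by X : nat -> T -> S; the values X i
   with k < i are irrelevant throughout. *)
Definition path_event (T : Type) (S : countType) (X : nat -> T -> S) (i : nat)
    (x : nat -> S) : set T :=
  [set w | forall j, (j <= i)%N -> X j w = x j].

Definition trajectory d (T : measurableType d) (R : realType) (S : countType)
    (M : markov_chain R S) (Pr : probability T R) (k : nat)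
    (X : nat -> T -> S) :=
  (forall i, (i <= k)%N -> discrete_rv (X i)) /\
  (forall (x : nat -> S) i, (i < k)%N -> Pr (path_event X i x) <> 0%E ->
    cond_prob Pr (X i.+1 @^-1` [set x i.+1]) (path_event X i x)
    = M (x i) (x i.+1)).

Definition trajectory_from d (T : measurableType d) (R : realType)
    (S : countType) (M : markov_chain R S) (Pr : probability T R) (k : nat)
    (s0 : S) (X : nat -> T -> S) :=
  trajectory M Pr k X /\ Pr (X 0%N @^-1` [set s0]) = 1%E.

Definition stationary_trajectory d (T : measurableType d) (R : realType)
    (S : countType) (M : markov_chain R S) (pi : S -> R)
    (Pr : probability T R) (k : nat) (X : nat -> T -> S) :=
  trajectory M Pr k X /\
  forall s, Pr (X 0%N @^-1` [set s]) = (pi s)%:E.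

Definition path_of (T : Type) (S : countType) (k : nat) (X : nat -> T -> S)
    (w : T) : k.+1.-tuple S :=
  [tuple X i w | i < k.+1].

Definition same_distribution d (T : measurableType d) (R : realType)
    (V : countType) (Pr : probability T R) (Y Z : T -> V) :=
  forall A : set V, Pr (Y @^-1` A) = Pr (Z @^-1` A).

Definition reversible (R : realType) (S : countType) (M : markov_chain R S)
    (pi : S -> R) :=
  forall (d : measure_display) (T : measurableType d) (Pr : probability T R)
    (k : nat) (X : nat -> T -> S),
  stationary_trajectory M pi Pr k X ->
  same_distribution Pr (path_of k X) (path_of k (fun i => X (k - i)%N)).

Definition independent d (T : measurableType d) (R : realType)
    (V : countType) (m : nat) (Pr : probability T R) (Y : 'I_m -> T -> V) :=
  forall (J : {set 'I_m}) (A : 'I_m -> set V),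
  (Pr (\bigcap_(i in [set` J]) (Y i @^-1` A i))
   = \prod_(i in J) Pr (Y i @^-1` A i))%E.

Definition is_outlier (R : realType) (eps : R) (k : nat) (a : nat -> R) : bool :=
  #|[pred i : 'I_k.+1 | a i <= a 0%N]|%:R <= eps * k.+1%:R.

Definition outlier_event (T : Type) (R : realType) (S : countType)
    (omega : S -> R) (eps : R) (k : nat) (X : nat -> T -> S) : set T :=
  [set w | is_outlier eps k (fun i => omega (X i w))].

(* The probability p^k_{0,eps}(s).  All trajectories X_0, ..., X_k from s have
   the same law, whatever probability space carries them, so exactly one real
   number belongs to the set below; xget selects it. *)
Definition outlier_prob (R : realType) (S : countType) (M : markov_chain R S)
    (omega : S -> R) (eps : R) (k : nat) (s : S) : R :=
  xget 0 [set p : R |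
    exists (d : measure_display) (T : measurableType d) (Pr : probability T R)
      (X : nat -> T -> S),
    trajectory_from M Pr k s X /\
    Pr (outlier_event omega eps k X) = p%:E].

Definition eps_alpha_outlier (R : realType) (S : countType)
    (M : markov_chain R S) (pi : S -> R) (omega : S -> R) (k : nat)
    (eps alpha : R) (s0 : S) :=
  (\esum_(s in [set s | (outlier_prob M omega eps k s0
                         <= outlier_prob M omega eps k s)%R])
     (pi s)%:E <= alpha%:E)%E.

(* Main.v *)
Require Import Defs.
From HB Require Import structures.
From mathcomp Require Import all_boot all_order all_algebra.
From mathcomp Require Import all_classical all_reals all_analysis.

Set Implicit Arguments.
Unset Strict Implicit.
Unset Printing Implicit Defensive.

Import Order.TTheory GRing.Theory Num.Theory.
Import numFieldNormedType.Exports.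

Local Open Scope classical_set_scope.
Local Open Scope ring_scope.

(* Write p(s) for the probability that omega(s) is an eps-outlier on a
   trajectory of length k from s, and put D = eps (k+1).  In a stationary
   trajectory Y_0, ..., Y_k and for fixed j, reversibility makes the two arms
   leaving Y_j independent trajectories from Y_j, of lengths j and k-j.  Cutting
   a trajectory short only lowers the rank of its first label, so with
   probability at least E_pi[p^2] both arms see rank at most D, and then Y_j has
   rank at most 2D in the whole path.  At most 2D indices j can have rank at
   most 2D; summing over j gives (k+1) E_pi[p^2] <= 2D, that is,
   E_pi[p^2] <= 2 eps.  If s0 is not an (eps, alpha)-outlier, then
   p(s)^2 >= p(s0)^2 on a set of pi-mass greater than alpha, so
   p(s0)^2 <= 2 eps / alpha, and independence raises this to the power m/2. *)

(** * Sums over arbitrary index sets *)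

Lemma esum_subset (R : realType) (T : choiceType) (A B : set T)
    (a : T -> \bar R) :
  A `<=` B -> (\esum_(i in A) a i <= \esum_(i in B) a i)%E.
Proof.
move=> AB; apply: ereal_sup_le => _ [F [finF FA] <-].
by exists F => //; split => // x /FA /AB.
Qed.

(** One inequality is checked on finite partial sums; the other is the same inequality for the
    factor [c^-1] and the family [c * a i]. *)
Lemma esumZl (R : realType) (T : choiceType) (A : set T) (c : R)
    (a : T -> \bar R) : 0 <= c -> (forall i, 0 <= a i)%E ->
  (\esum_(i in A) (c%:E * a i) = c%:E * \esum_(i in A) a i)%E.
Proof.
have le_esumZ (e : R) (b : T -> \bar R) : 0 <= e -> (forall i, 0 <= b i)%E ->
    (\esum_(i in A) (e%:E * b i) <= e%:E * \esum_(i in A) b i)%E.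
  move=> e0 b0; apply: ge_ereal_sup => _ [F [finF FA] <-].
  rewrite fsbig_finite//= -ge0_sume_distrr// lee_wpmul2l ?lee_fin//.
  by apply: esum_ge; exists F => //; rewrite fsbig_finite.
rewrite le_eqVlt => /predU1P[<-|c0] a0.
  by rewrite mul0e esum1// => i _; rewrite mul0e.
apply/eqP; rewrite eq_le le_esumZ ?(ltW c0)//=.
have ca0 i : (0 <= c%:E * a i)%E by rewrite mule_ge0// lee_fin ltW.
have aE i : a i = (c^-1%:E * (c%:E * a i))%E.
  by rewrite muleA -EFinM mulVf ?gt_eqF// mul1e.
rewrite [leLHS](_ : _ = c%:E * \esum_(i in A) (c^-1%:E * (c%:E * a i)))%E.
  apply: (le_trans (lee_wpmul2l _ (le_esumZ c^-1 _ _ ca0))).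
  - by rewrite lee_fin ltW.
  - by rewrite invr_ge0 ltW.
  - by rewrite muleA -EFinM divff ?gt_eqF// mul1e.
by congr (_ * _)%E; apply: eq_esum.
Qed.

Lemma esumZr (R : realType) (T : choiceType) (A : set T) (c : R)
    (a : T -> \bar R) : 0 <= c -> (forall i, 0 <= a i)%E ->
  (\esum_(i in A) (a i * c%:E) = (\esum_(i in A) a i) * c%:E)%E.
Proof.
move=> c0 a0; rewrite muleC -esumZl//.
by apply: eq_esum => i _; rewrite muleC.
Qed.

(** * Countable additivity and realization of mass functions *)

Lemma measure_esum_bigcup d (T : measurableType d) (R : realType)
    (mu : {measure set T -> \bar R}) (I : countType) (D : set I)
    (F : I -> set T) :
  (forall i, D i -> measurable (F i)) -> trivIset D F ->
  (mu (\bigcup_(i in D) F i) = \esum_(i in D) mu (F i))%E.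
Proof.
move=> mF tF; pose G n := if unpickle n is Some i then F i else set0.
have GF i : G (pickle i) = F i by rewrite /G pickleK.
have -> : \bigcup_(i in D) F i = \bigcup_(n in pickle @` D) G n.
  by rewrite bigcup_image; apply: eq_bigcupr => i _; rewrite GF.
rewrite measure_bigcup; last 2 first.
- by move=> _ [i Di <-]; rewrite GF; exact: mF.
- by move=> _ _ [i Di <-] [j Dj <-]; rewrite !GF => /(tF _ _ Di Dj) ->.
rewrite nneseries_esum// set_mem_set esum_image.
  by apply: eq_esum => i _; rewrite GF.
by move=> i j _ _ /(pcan_inj pickleK).
Qed.

(* The pushforward of [p] along [pickle] : [nat] already carries the discrete
   sigma-algebra, whereas an arbitrary [countType] is not a measurable type. *)
Definition pickle_pmf (R : realType) (V : countType) (p : V -> R)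
    (hp : is_pmf p) (A : set nat) : \bar R :=
  (\esum_(v in pickle @^-1` A) (p v)%:E)%E.

Lemma pickle_pmf0 (R : realType) (V : countType) (p : V -> R) (hp : is_pmf p) :
  pickle_pmf hp set0 = 0%E.
Proof. by rewrite /pickle_pmf preimage_set0 esum_set0. Qed.

Lemma pickle_pmf_ge0 (R : realType) (V : countType) (p : V -> R)
  (hp : is_pmf p) (A : set nat) : (0 <= pickle_pmf hp A)%E.
Proof. by apply: esum_ge0 => v _; rewrite lee_fin; apply: hp.1. Qed.

Lemma pickle_pmf_sigma_additive (R : realType) (V : countType) (p : V -> R)
  (hp : is_pmf p) : semi_sigma_additive (pickle_pmf hp).
Proof.
move=> F mF tF mUF; rewrite /pickle_pmf preimage_bigcup esum_bigcupT.
- rewrite -nneseries_esumT; last by move=> n; exact: pickle_pmf_ge0.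
  by apply: is_cvg_nneseries => n _ _; exact: pickle_pmf_ge0.
- by move=> i j _ _ [v [Fi Fj]]; apply: (tF i j) => //; exists (pickle v).
- by move=> v; rewrite lee_fin; apply: hp.1.
Qed.

HB.instance Definition _ (R : realType) (V : countType) (p : V -> R)
    (hp : is_pmf p) := isMeasure.Build _ nat R (pickle_pmf hp)
  (pickle_pmf0 hp) (pickle_pmf_ge0 hp) (@pickle_pmf_sigma_additive _ _ _ hp).

Lemma pickle_pmfT (R : realType) (V : countType) (p : V -> R)
  (hp : is_pmf p) : pickle_pmf hp setT = 1%E.
Proof. by rewrite /pickle_pmf preimage_setT hp.2. Qed.

HB.instance Definition _ (R : realType) (V : countType) (p : V -> R)
    (hp : is_pmf p) :=
  Measure_isProbability.Build _ nat R (pickle_pmf hp) (pickle_pmfT hp).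

(** Reversibility speaks of random trajectories, so using it requires realizing a given law. The
    default [v0] is taken only at integers outside the image of [pickle], which carry no mass. *)
Lemma ex_rv_of_pmf (R : realType) (V : countType) (p : V -> R) (v0 : V) :
  is_pmf p -> exists (Pr : probability nat R) (Y : nat -> V),
    forall A, Pr (Y @^-1` A) = (\esum_(v in A) (p v)%:E)%E.
Proof.
move=> hp; exists (pickle_pmf hp : probability nat R).
exists (fun n => odflt v0 (unpickle n)) => A.
rewrite /= /pickle_pmf; congr esum; apply/seteqP.
by split=> v /=; rewrite pickleK.
Qed.

(** * Detailed balance *)

(** Reversibility is applied to a one-step stationary trajectory, realized from the law
    [pi s * M s t] on pairs of states. *)
Lemma detailed_balance (R : realType) (S : countType) (M : markov_chain R S)
    (pi : S -> R) :
  stationary M pi -> reversible M pi ->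
  forall s t, pi s * M s t = pi t * M t s.
Proof.
move=> [[pi0 pi1] _] Mrev s t.
have M0 u v : 0 <= M u v by apply: (trans_pmf M u).1.
pose p (x : S * S) := pi x.1 * M x.1 x.2.
have p0 x : (0 <= (p x)%:E)%E by rewrite lee_fin mulr_ge0.
have sum_fst (A : set S) : (\esum_(x in fst @^-1` A) (p x)%:E =
    \esum_(u in A) (pi u)%:E)%E.
  transitivity (\esum_(u in A) \esum_(v in [set: S]) (p (u, v))%:E)%E.
    rewrite esum_esum//.
    rewrite (_ : A `*`` _ = fst @^-1` A); first by apply: eq_esum => -[].
    by apply/seteqP; split=> -[u v] //= [].
  apply: eq_esum => u _.
  rewrite (eq_esum (b := fun v => (pi u)%:E * (M u v)%:E)%E)//.
  by rewrite esumZl// ?(trans_pmf M u).2 ?mule1// => v; rewrite lee_fin.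
have [|Pr [Y PrY]] := @ex_rv_of_pmf R _ p (s, s).
  split=> [x|]; first by rewrite -lee_fin.
  by rewrite -[setT](preimage_setT fst) sum_fst.
pose X i w := if i is 0%N then (Y w).1 else (Y w).2.
have PrX0 u : Pr (X 0%N @^-1` [set u]) = (pi u)%:E.
  by rewrite (PrY (fst @^-1` [set u])) sum_fst esum_set1// lee_fin.
have PrX u v : Pr [set w | X 0%N w = u /\ X 1%N w = v] = (pi u * M u v)%:E.
  have := PrY [set (u, v)]; rewrite esum_set1// => <-; congr (Pr _).
  by apply/seteqP; split=> w /=; rewrite /X; case: (Y w) => /= a b [-> ->].
have Xtraj : stationary_trajectory M pi Pr 1 X.
  split=> //; split=> [i _ u|x [|//] _]; first by [].
  have -> : path_event X 0 x = X 0%N @^-1` [set x 0%N].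
    apply/seteqP; split=> w /=; first by move/(_ 0%N); exact.
    by move=> Xx j; rewrite leqn0 => /eqP ->.
  rewrite /cond_prob PrX0 => pix0.
  rewrite [X in Pr X](_ : _ = [set w | X 0%N w = x 0%N /\ X 1%N w = x 1%N]).
    rewrite PrX /= mulrAC divff ?mul1r//.
    by apply: contra_notN pix0 => /eqP ->.
  by apply/seteqP; split=> w /= [].
(* For [k = 1] the reversed path is [X 1, X 0], so running through [[:: s; t]] in reverse means
   [X 0 = t] and [X 1 = s]. *)
have /(_ [set tu | tu = [tuple of [:: s; t]]]) := Mrev _ _ _ _ _ Xtraj.
rewrite [X in Pr X = _ -> _](_ : _ = [set w | X 0%N w = s /\ X 1%N w = t]).
  rewrite [X in _ = Pr X -> _](_ : _ = [set w | X 0%N w = t /\ X 1%N w = s]).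
    by rewrite !PrX => -[].
  apply/seteqP; split=> w /=.
    by move=> /(congr1 val) /=; rewrite enum_ordSl enum_ordSl enum_ord0 => -[].
  move=> [<- <-]; apply/val_inj.
  by rewrite /= enum_ordSl enum_ordSl enum_ord0.
apply/seteqP; split=> w /=.
  by move=> /(congr1 val) /=; rewrite enum_ordSl enum_ordSl enum_ord0 => -[].
by move=> [<- <-]; apply/val_inj; rewrite /= enum_ordSl enum_ordSl enum_ord0.
Qed.

(** * Weights of finite paths *)

Section PathWeight.
Context (R : realType) (S : countType) (M : markov_chain R S) (pi : S -> R).

(** The list omits the starting state, so its size is the number of steps. *)
Fixpoint path_weight (s : S) (l : seq S) : R :=
  if l is t :: l' then M s t * path_weight t l' else 1.

Definition stationary_weight (l : seq S) : R :=
  if l is s :: l' then pi s * path_weight s l' else 1.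

Lemma path_weight_ge0 s l : 0 <= path_weight s l.
Proof.
by elim: l s => //= t l IHl s; rewrite mulr_ge0//; apply: (trans_pmf M s).1.
Qed.

Lemma path_weight_cat s a b :
  path_weight s (a ++ b) = path_weight s a * path_weight (last s a) b.
Proof. by elim: a s => /= [|t a IHa] s; rewrite ?mul1r// IHa mulrA. Qed.

Lemma path_weight_rcons s a t :
  path_weight s (rcons a t) = path_weight s a * M (last s a) t.
Proof. by rewrite -cats1 path_weight_cat /= mulr1. Qed.

Lemma last_rev_belast (s : S) a : last (last s a) (rev (belast s a)) = s.
Proof. by case: a => //= t a; rewrite rev_cons last_rcons. Qed.

Hypothesis balanced : forall s t, pi s * M s t = pi t * M t s.

(** The reverse of [s :: a] is [last s a :: rev (belast s a)]; detailed balance turns the steps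
    around one at a time. *)
Lemma path_weight_rev s a :
  pi (last s a) * path_weight (last s a) (rev (belast s a))
  = pi s * path_weight s a.
Proof.
elim: a s => //= t a IHa s.
rewrite rev_cons path_weight_rcons last_rev_belast mulrA IHa.
by rewrite mulrAC -balanced mulrA.
Qed.

(** The path starts at [last s a]; reversing its first part moves the factor [pi] to the pivot
    [s]. *)
Lemma stationary_weight_pivot s a b :
  stationary_weight (rev a ++ s :: b)
  = pi s * path_weight s a * path_weight s b.
Proof.
rewrite -cat_rcons -rev_cons lastI rev_rcons /=.
by rewrite path_weight_cat mulrA path_weight_rev last_rev_belast.
Qed.

End PathWeight.
Lemma card_ord_count (n : nat) (P : pred nat) :
  #|[pred i : 'I_n | P i]| = count P (iota 0 n).
Proof. by rewrite cardE size_filter -val_enum_ord count_map -enumT. Qed.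

(** Each longer path is a shorter one with a last state appended, and summing over that state gives
    total transition mass 1. *)
Lemma esum_path_weight_extend (R : realType) (S : countType)
    (M : markov_chain R S) (s : S) (n : nat) (P Q : seq S -> Prop) :
  (forall b t, P (rcons b t) -> Q b) ->
  (\esum_(b in [set b | size b = n.+1 /\ P b]) (path_weight M s b)%:E
   <= \esum_(b in [set b | size b = n /\ Q b]) (path_weight M s b)%:E)%E.
Proof.
move=> PQ; pose A := [set b | size b = n /\ Q b].
pose snoc (x : seq S * S) := rcons x.1 x.2.
have M0 u v : (0 <= (M u v)%:E)%E by rewrite lee_fin; apply: (trans_pmf M u).1.
have W0 b : 0 <= path_weight M s b := path_weight_ge0 M s b.
apply: (@le_trans _ _
    (\esum_(b in snoc @` (A `*` [set: S])) (path_weight M s b)%:E)%E).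
  apply: esum_subset => b [sb Pb]; case/lastP: b sb Pb => // b t.
  rewrite size_rcons => -[sb] Pb; exists (b, t) => //.
  by do 2!split=> //; exact: PQ Pb.
rewrite esum_image; last first.
  by move=> [b t] [c u] _ _ /rcons_inj [-> ->].
rewrite -(@esum_esum _ _ _ A (fun=> setT)
  (fun b t => (path_weight M s (rcons b t))%:E)).
  apply: le_esum => b _.
  under eq_esum do rewrite path_weight_rcons EFinM.
  by rewrite esumZl// (trans_pmf M _).2 mule1.
by move=> b t _ _; rewrite lee_fin path_weight_ge0.
Qed.

Lemma esum_path_weight_le1 (R : realType) (S : countType)
    (M : markov_chain R S) (s : S) (n : nat) :
  (\esum_(b in [set b | size b = n]) (path_weight M s b)%:E <= 1)%E.
Proof.
elim: n => [|n IHn].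
  rewrite (_ : [set b | _] = [set [::]]) ?esum_set1 ?lee_fin ?ler01//.
  by apply/seteqP; split=> b /=; [move/size0nil|move->].
apply: le_trans IHn.
have := @esum_path_weight_extend R S M s n (fun=> True) (fun=> True).
have T m : [set b : seq S | size b = m /\ True] = [set b | size b = m].
  by apply/seteqP; split=> b /= => [[]|].
by rewrite !T; apply.
Qed.

Lemma esum_stationary_weight_le1 (R : realType) (S : countType)
    (M : markov_chain R S) (pi : S -> R) (n : nat) : is_pmf pi ->
  (\esum_(l in [set l | size l = n.+1]) (stationary_weight M pi l)%:E <= 1)%E.
Proof.
move=> [pi0 pi1]; pose A := [set b : seq S | size b = n].
pose consp (x : S * seq S) := x.1 :: x.2.
apply: (@le_trans _ _ (\esum_(b in consp @` ([set: S] `*` A))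
    (stationary_weight M pi b)%:E)%E).
  by apply: esum_subset => -[//|s b] /= [sb]; exists (s, b).
rewrite esum_image; last by move=> [b t] [c u] _ _ [-> ->].
rewrite -(@esum_esum _ _ _ setT (fun=> A)
  (fun s b => (stationary_weight M pi (s :: b))%:E)).
  rewrite -pi1; apply: le_esum => s _ /=.
  under eq_esum do rewrite EFinM.
  rewrite esumZl//; last by move=> b; rewrite lee_fin path_weight_ge0.
  by rewrite -[leRHS]mule1 lee_wpmul2l ?lee_fin ?esum_path_weight_le1.
by move=> s b _ _; rewrite lee_fin mulr_ge0// path_weight_ge0.
Qed.

(** * Ranks of labels in a list *)

Definition rank_below (R : realType) (S : Type) (omega : S -> R) (s : S)
    (l : seq S) : nat :=
  count (fun t => omega t <= omega s) l.

Lemma ex_seq_max (R : realType) (S : eqType) (f : S -> R) (l : seq S) :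
  l != [::] -> exists2 x, x \in l & all (fun t => f t <= f x) l.
Proof.
elim: l => // x [_ _|y l /(_ isT) [z zl zmax] _].
  by exists x; rewrite ?mem_head//= lexx.
have [xz|/ltW zx] := leP (f x) (f z).
  by exists z; [rewrite mem_behead|apply/andP].
exists x; first exact: mem_head.
apply/andP; split=> //; apply: sub_all zmax => t /le_trans; exact.
Qed.

(* The elements of rank at most [D] all lie below the one with the largest
   label, so there are at most [D] of them. *)
Lemma count_low_rank (R : realType) (S : eqType) (omega : S -> R) (l : seq S)
    (D : R) : 0 <= D ->
  (count (fun s => (rank_below omega s l)%:R <= D) l)%:R <= D.
Proof.
move=> D0; set p := fun s => _.
have [l0|/(ex_seq_max omega) [x]] := eqVneq [seq s <- l | p s] [::].
  by rewrite -size_filter l0.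
rewrite mem_filter => /andP[px _] xmax; apply: le_trans px.
(* All elements of the filtered list have label at most that of [x], so its size is a count of such
   elements, bounded by the rank of [x] in [l]. *)
rewrite ler_nat -size_filter -(eqP (etrans (esym (all_count _ _)) xmax)).
by rewrite count_filter; apply: sub_count => t /andP[].
Qed.

(** * Probability of low rank along a path, and its second moment *)

(** This is p(s) written as a sum over paths when [D = eps * k.+1%:R] and [n = k]. The threshold is
    kept separate from the length so that it stays fixed when a path is cut short. *)
Definition low_prob (R : realType) (S : countType) (M : markov_chain R S)
    (omega : S -> R) (D : R) (n : nat) (s : S) : \bar R :=
  (\esum_(b in [set b | size b = n /\
      ((rank_below omega s (s :: b))%:R <= D)%R])
    (path_weight M s b)%:E)%E.

Section LowProb.
Context (R : realType) (S : countType) (M : markov_chain R S) (omega : S -> R).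
Context (D : R).

Lemma low_prob_ge0 n s : (0 <= low_prob M omega D n s)%E.
Proof. by apply: esum_ge0 => b _; rewrite lee_fin path_weight_ge0. Qed.

Lemma low_prob_le1 n s : (low_prob M omega D n s <= 1)%E.
Proof.
apply: le_trans (esum_path_weight_le1 M s n).
by apply: esum_subset => b [].
Qed.

Lemma low_prob_fin n s : low_prob M omega D n s \is a fin_num.
Proof.
by rewrite ge0_fin_numE ?low_prob_ge0// (le_lt_trans (low_prob_le1 _ _)) ?ltry.
Qed.

Lemma low_prob_anti n n' s : (n <= n')%N ->
  (low_prob M omega D n' s <= low_prob M omega D n s)%E.
Proof.
move=> /subnK <-; elim: (n' - n)%N => // i; apply: le_trans.
rewrite addSn; apply: esum_path_weight_extend => b t; apply: le_trans.
by rewrite ler_nat -rcons_cons /rank_below -cats1 count_cat leq_addr.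
Qed.

End LowProb.
(* Two independent arms [a] and [b] from [s] are glued into the single path
   [rev a ++ s :: b], whose stationary weight is the product of the arms'. *)
Lemma esum_low_prob_pivot (R : realType) (S : countType) (M : markov_chain R S)
    (pi omega : S -> R) (D : R) (x0 : S) (i j : nat) :
  (forall s, 0 <= pi s) -> (forall s t, pi s * M s t = pi t * M t s) ->
  (\esum_(s in [set: S])
      ((pi s)%:E * (low_prob M omega D i s * low_prob M omega D j s))
   <= \esum_(l in [set l | size l = (i + j).+1 /\
        ((rank_below omega (nth x0 l i) l)%:R <= 2 * D)%R])
      (stationary_weight M pi l)%:E)%E.
Proof.
move=> pi0 balanced.
pose A n s := [set b : seq S |
  size b = n /\ (rank_below omega s (s :: b))%:R <= D].
have W0 s b : (0 <= (path_weight M s b)%:E)%E.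
  by rewrite lee_fin path_weight_ge0.
pose B s := A i s `*` A j s.
pose glue (x : S * (seq S * seq S)) := rev x.2.1 ++ x.1 :: x.2.2.
have glueE s ab : ((stationary_weight M pi (glue (s, ab)))%:E = (pi s)%:E *
    ((path_weight M s ab.1)%:E * (path_weight M s ab.2)%:E))%E.
  by rewrite stationary_weight_pivot// -!EFinM mulrA.
have WW0 s a b : (0 <= (path_weight M s a)%:E * (path_weight M s b)%:E)%E.
  by rewrite mule_ge0.
apply: (@le_trans _ _ (\esum_(l in glue @` ([set: S] `*`` B))
    (stationary_weight M pi l)%:E)%E); last first.
  apply: esum_subset => _ [[s [a b]] [_ [[sa ra] [sb rb]]] <-] /=.
  rewrite /glue /= size_cat size_rev /= sa sb addnS; split=> //.
  rewrite nth_cat size_rev sa ltnn subnn /=.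
  (* The state [s] is counted once in the glued path but once in each arm, so the rank in the whole
     is at most the sum of the arm ranks. *)
  rewrite /rank_below count_cat count_rev natrD mulr_natl mulr2n lerD//.
  by apply: le_trans ra; rewrite ler_nat /rank_below /= leq_addl.
(* Since the first arm has the fixed length [i], a glued path determines its pivot and both arms. *)
rewrite esum_image; last first.
  move=> [s [a b]] [s' [a' b']] /[!inE] -[_ [[sa _] _]] [_ [[sa' _] _]] /eqP.
  rewrite /glue /= eqseq_cat ?size_rev ?sa ?sa'//.
  by move=> /andP[/eqP /(can_inj revK) -> /eqP [-> ->]].
rewrite -(@esum_esum _ _ _ setT B
  (fun s ab => (stationary_weight M pi (glue (s, ab)))%:E)); last first.
  by move=> s ab _ _; rewrite glueE; apply: mule_ge0; [rewrite lee_fin|].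
apply: le_esum => s _.
under [leRHS]eq_esum do rewrite glueE.
rewrite esumZl//.
rewrite lee_wpmul2l ?lee_fin//.
rewrite -(@esum_esum _ _ _ (A i s) (fun=> A j s)
  (fun a b => (path_weight M s a)%:E * (path_weight M s b)%:E)%E)//.
rewrite -(fineK (low_prob_fin M omega D j s)) -esumZr//; last first.
  by apply: fine_ge0; exact: low_prob_ge0.
apply: le_esum => a _; rewrite fineK ?low_prob_fin//.
by rewrite esumZl ?path_weight_ge0.
Qed.

Lemma esum_low_prob_sq (R : realType) (S : countType) (M : markov_chain R S)
    (pi omega : S -> R) (eps : R) (x0 : S) (k : nat) :
  is_pmf pi -> (forall s t, pi s * M s t = pi t * M t s) -> 0 < eps ->
  (\esum_(s in [set: S]) ((pi s)%:E * (low_prob M omega (eps * k.+1%:R) k s *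
      low_prob M omega (eps * k.+1%:R) k s)) <= (2 * eps)%:E)%E.
Proof.
move=> hpi balanced eps0; set D := eps * k.+1%:R.
have D0 : 0 <= 2 * D by rewrite !mulr_ge0// ltW.
set E2 := (\esum_(s in _) _)%E.
pose low l j := ((rank_below omega (nth x0 l j) l)%:R <= 2 * D)%R.
have SW0 l : (0 <= (stationary_weight M pi l)%:E)%E.
  by case: l => [|s l]; rewrite lee_fin// mulr_ge0 ?path_weight_ge0 ?hpi.1.
have E2j (j : 'I_k.+1) : (E2 <= \esum_(l in [set l | size l = k.+1])
    (if low l j then (stationary_weight M pi l)%:E else 0))%E.
  have jk : (j <= k)%N by rewrite -ltnS.
  apply: (@le_trans _ _ (\esum_(s in [set: S]) ((pi s)%:E *
      (low_prob M omega D j s * low_prob M omega D (k - j) s)))%E).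
    (* Both arm lengths [j] and [k - j] are at most [k], so shortening from [k] only increases each
       factor. *)
    apply: le_esum => s _; rewrite lee_wpmul2l ?lee_fin ?hpi.1//.
    apply: lee_pmul; rewrite ?low_prob_ge0//; apply: low_prob_anti => //.
    exact: leq_subr.
  apply: le_trans (esum_low_prob_pivot _ _ x0 _ _ hpi.1 balanced) _.
  rewrite subnKC// (_ : [set l | _] =
    [set l | size l = k.+1] `&` [set l | low l j])//.
  rewrite esum_mkcondr; apply: le_esum => l _.
  by case: ifPn => [/[!inE] /= ->//|_]; case: ifP.
(* Adding the bounds over [j] and exchanging the sums leaves, for each path, its number of low-rank
   positions, at most [2 * D], which equals [k.+1%:R * (2 * eps)]. *)
have kE2 : (k.+1%:R%:E * E2 <= k.+1%:R%:E * (2 * eps)%:E)%E.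
  have -> : (k.+1%:R%:E * E2 = \sum_(j < k.+1) E2)%E.
    under eq_bigr do rewrite -[E2]mul1e.
    by rewrite -ge0_sume_distrl// sumEFin sumr_const card_ord.
  apply: le_trans (lee_sum _ (fun j _ => E2j j)) _.
  rewrite -esum_sum; last by move=> l j _ _; case: ifP.
  apply: (@le_trans _ _ (\esum_(l in [set l | size l = k.+1])
      ((2 * D)%:E * (stationary_weight M pi l)%:E))%E).
    apply: le_esum => l sl; rewrite -big_mkcond /= sumEFin lee_fin.
    rewrite sumr_const -[leLHS]mulr_natl.
    apply: ler_wpM2r; first by rewrite -lee_fin.
    apply: le_trans (count_low_rank omega l D0).
    rewrite (card_ord_count _ (low l)).
    by rewrite -[X in _ <= (count _ X)%:R](mkseq_nth x0 l) sl count_map.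
  rewrite esumZl// -EFinM.
  apply: le_trans (lee_wpmul2l _ (esum_stationary_weight_le1 M k hpi)) _.
    by rewrite lee_fin.
  by rewrite mule1 lee_fin /D mulrA mulrC.
by rewrite lee_pmul2l ?lte_fin in kE2.
Qed.

(** * Laws of trajectories on an arbitrary probability space *)

Lemma measurable_path_event d (T : measurableType d) (S : countType)
    (X : nat -> T -> S) (k n : nat) (x : nat -> S) :
  (forall i, (i <= k)%N -> discrete_rv (X i)) -> (n <= k)%N ->
  measurable (path_event X n x).
Proof.
move=> mX nk; rewrite [path_event _ _ _](_ : _ =
    \bigcap_(j in [set j | (j <= n)%N]) (X j @^-1` [set x j])).
  apply: bigcap_measurable => [|j jn]; first by exists 0%N.
  by apply: mX; exact: leq_trans nk.
by apply/seteqP; split=> w /= Xx j /Xx.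
Qed.

Lemma path_eventE (T : Type) (S : countType) (X : nat -> T -> S) (x0 : S)
    (n : nat) (l : seq S) : size l = n.+1 ->
  path_event X n (nth x0 l) = [set w | mkseq (fun i => X i w) n.+1 = l].
Proof.
move=> sl; apply/seteqP; split=> w /=.
  move=> Xl; apply: (@eq_from_nth _ x0); rewrite size_mkseq// => i ni.
  by rewrite nth_mkseq// Xl.
by move=> <- j jn; rewrite nth_mkseq.
Qed.

Lemma trajectory_path_event d (T : measurableType d) (R : realType)
    (S : countType) (M : markov_chain R S) (Pr : probability T R) (k : nat)
    (s : S) (X : nat -> T -> S) (b : seq S) :
  trajectory_from M Pr k s X -> (size b <= k)%N ->
  Pr (path_event X (size b) (nth s (s :: b))) = (path_weight M s b)%:E.
Proof.
move=> [[mX PX] X0]; elim/last_ind: b => [_|b t IHb].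
  rewrite -X0 /=; congr (Pr _); apply/seteqP; split=> w /=.
    by move=> /(_ 0%N); exact.
  by move=> Xs j; rewrite leqn0 => /eqP ->.
rewrite size_rcons => bk; have {}IHb := IHb (ltnW bk).
set x := nth s (s :: rcons b t).
have Eb : path_event X (size b) x = path_event X (size b) (nth s (s :: b)).
  have xE j : (j <= size b)%N -> x j = nth s (s :: b) j.
    by move=> jb; rewrite /x -rcons_cons nth_rcons /= ltnS jb.
  by apply/seteqP; split=> w Xx j jb; rewrite Xx// xE.
have xt : x (size b).+1 = t by rewrite /x /= nth_rcons ltnn eqxx.
have xb : x (size b) = last s b.
  rewrite /x -rcons_cons nth_rcons /= ltnSn.
  by rewrite -[size b]/((size (s :: b)).-1) nth_last.
have -> : path_event X (size b).+1 x =
    X (size b).+1 @^-1` [set x (size b).+1] `&` path_event X (size b) x.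
  apply/seteqP; split=> w /=.
    by move=> Xx; split=> [|j jb]; apply: Xx => //; exact: leqW.
  by move=> [Xx1 Xx] j; rewrite leq_eqVlt => /predU1P[->//|/Xx].
have mXt : measurable (X (size b).+1 @^-1` [set x (size b).+1]) by exact: mX.
have mEb : measurable (path_event X (size b) x).
  by apply: (measurable_path_event x mX); exact: ltnW.
(* A trajectory has prescribed conditional probabilities only after non-null prefixes; after a null
   prefix both sides vanish, by monotonicity of the measure. *)
rewrite path_weight_rcons; have [W0|W0] := eqVneq (path_weight M s b) 0.
  rewrite W0 mul0r; apply/eqP; rewrite eq_le measure_ge0 andbT.
  rewrite -[leRHS]/0%:E -W0 -IHb -Eb.
  by apply: le_measure; rewrite ?inE//; exact: measurableI.
have PEb : Pr (path_event X (size b) x) <> 0%E.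
  by rewrite Eb IHb => -[] /eqP; rewrite (negPf W0).
have := PX x _ bk PEb; rewrite Eb /cond_prob IHb /= xt xb -xt.
move=> /(congr1 ( *%R^~ (path_weight M s b))).
rewrite /= divfK// mulrC => <-; rewrite fineK//.
by apply: fin_num_measure; rewrite -Eb; exact: measurableI.
Qed.

Lemma probability_setI1 d (T : measurableType d) (R : realType)
    (Pr : probability T R) (A B : set T) :
  measurable A -> measurable B -> Pr B = 1%E -> Pr (A `&` B) = Pr A.
Proof.
move=> mA mB PB; rewrite -[LHS]add0e [RHS](measureDI Pr mA mB); congr (_ + _)%E.
apply/esym/eqP; rewrite eq_le measure_ge0 andbT.
have -> : (0 = Pr (~` B))%E by rewrite probability_setC// PB subee.
apply: le_measure; rewrite ?inE; last by move=> w [].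
  exact: measurableD.
exact: measurableC.
Qed.

Lemma outlier_eventE (T : Type) (R : realType) (S : countType)
    (omega : S -> R) (eps : R) (k : nat) (X : nat -> T -> S) (w : T) :
  outlier_event omega eps k X w =
  ((rank_below omega (X 0%N w) (mkseq (fun i => X i w) k.+1))%:R
    <= eps * k.+1%:R) :> Prop.
Proof.
rewrite /outlier_event /= /is_outlier.
rewrite (card_ord_count _ (fun i => omega (X i w) <= omega (X 0%N w))).
by rewrite /rank_below /mkseq count_map.
Qed.

(** Up to a null event, the outlier event is a countable disjoint union of path events, whose
    probabilities are path weights. *)
Lemma outlier_event_prob d (T : measurableType d) (R : realType)
    (S : countType) (M : markov_chain R S) (Pr : probability T R)
    (omega : S -> R) (eps : R) (k : nat) (s : S) (X : nat -> T -> S) :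
  trajectory_from M Pr k s X ->
  Pr (outlier_event omega eps k X) = low_prob M omega (eps * k.+1%:R) k s.
Proof.
move=> Xtraj; have [[mX _] X0] := Xtraj; set D := eps * _.
pose out l := (rank_below omega (nth s l 0) l)%:R <= D.
have mk w : nth s (mkseq (fun i => X i w) k.+1) 0 = X 0%N w by [].
pose E l := path_event X k (nth s l).
have mE l : measurable (E l) := measurable_path_event (nth s l) mX (leqnn k).
have mout : measurable (outlier_event omega eps k X).
  rewrite (_ : outlier_event _ _ _ _ =
      \bigcup_(l in [set l | size l = k.+1 /\ out l]) E l).
    rewrite bigcup_mkcond; apply: countable_bigcupT_measurable => // l.
    by case: ifP.
  apply/seteqP; split=> w.
    rewrite outlier_eventE => outw.
    exists (mkseq (fun i => X i w) k.+1).
      by split; [rewrite size_mkseq|].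
    by rewrite /E path_eventE ?size_mkseq.
  move=> [l [sl outl]]; rewrite /E path_eventE//= => wl.
  by rewrite outlier_eventE wl -mk wl.
(* The trajectory starts at [s] only almost surely, so the event is first intersected with
   [X 0 = s]. *)
rewrite -(probability_setI1 mout (mX 0%N (leq0n _) s) X0).
pose B := [set b | size b = k /\ (rank_below omega s (s :: b))%:R <= D].
have -> : outlier_event omega eps k X `&` X 0%N @^-1` [set s] =
    \bigcup_(b in B) E (s :: b).
  apply/seteqP; split=> w.
    move=> [/[!outlier_eventE] outw X0w].
    have wE : mkseq (fun i => X i w) k.+1 = s :: mkseq (fun i => X i.+1 w) k.
      by rewrite /mkseq /= (iotaDl 1 0) -map_comp X0w.
    exists (mkseq (fun i => X i.+1 w) k).
      by split; [rewrite size_mkseq|rewrite -wE -{1}X0w].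
    by rewrite /E path_eventE//= size_map size_iota.
  move=> [b [sb outb]]; rewrite /E path_eventE /= ?sb// => wb.
  have X0w : X 0%N w = s by rewrite -mk wb.
  by split=> //; rewrite outlier_eventE wb X0w.
rewrite measure_esum_bigcup//; last first.
  move=> b c [sb _] [sc _] [w]; rewrite /E !path_eventE /= ?sb ?sc//.
  by move=> [-> [<-]].
apply: eq_esum => b [sb _].
by have := trajectory_path_event (b := b) Xtraj; rewrite sb; apply.
Qed.

(* Only an inequality, since [outlier_prob] would be the junk value 0 if no
   trajectory from [s] were realizable. *)
Lemma outlier_prob_le (R : realType) (S : countType) (M : markov_chain R S)
    (omega : S -> R) (eps : R) (k : nat) (s : S) :
  ((outlier_prob M omega eps k s)%:E
   <= low_prob M omega (eps * k.+1%:R) k s)%E.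
Proof.
rewrite /outlier_prob.
case: xgetP => [p _ [d [T [Pr [X [Xtraj <-]]]]]|_]; last exact: low_prob_ge0.
by rewrite (outlier_event_prob _ _ Xtraj).
Qed.

(** An actual trajectory from [s] makes the set under [xget] nonempty, so the default 0 is
    excluded. *)
Lemma outlier_probE d (T : measurableType d) (R : realType)
    (S : countType) (M : markov_chain R S) (Pr : probability T R)
    (omega : S -> R) (eps : R) (k : nat) (s : S) (X : nat -> T -> S) :
  trajectory_from M Pr k s X ->
  (outlier_prob M omega eps k s)%:E = low_prob M omega (eps * k.+1%:R) k s.
Proof.
move=> Xtraj; rewrite /outlier_prob.
case: xgetP => [p _ [d' [T' [Pr' [X' [Xtraj' <-]]]]]|].
  by rewrite (outlier_event_prob _ _ Xtraj').
move=> /(_ (fine (Pr (outlier_event omega eps k X)))) []; exists d, T, Pr, X.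
split=> //; rewrite fineK// (outlier_event_prob _ _ Xtraj).
exact: low_prob_fin.
Qed.

(** * From the second moment to independent trajectories *)

(** This is Chebyshev's argument: the states with outlier probability at least [q] have mass above
    [alpha] and each contributes at least [q ^+ 2] times its mass to the second moment. *)
Lemma low_prob_sq_le (R : realType) (S : countType) (M : markov_chain R S)
    (pi omega : S -> R) (k : nat) (eps alpha q : R) (s0 : S) :
  stationary M pi -> reversible M pi -> 0 < eps -> 0 < alpha -> 0 <= q ->
  outlier_prob M omega eps k s0 = q ->
  low_prob M omega (eps * k.+1%:R) k s0 = q%:E ->
  ~ eps_alpha_outlier M pi omega k eps alpha s0 ->
  q ^+ 2 <= 2 * eps / alpha.
Proof.
move=> hstat hrev eps0 alpha0 q0 p0E q0E /negP; rewrite -ltNge p0E => alpha_lt.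
have pi0 : forall s, 0 <= pi s := hstat.1.1.
rewrite ler_pdivlMr// -lee_fin.
apply: le_trans (esum_low_prob_sq omega s0 k hstat.1
  (detailed_balance hstat hrev) eps0).
set Q := low_prob _ _ _ _.
rewrite EFinM; apply: (le_trans (lee_wpmul2l _ (ltW alpha_lt))).
  by rewrite lee_fin sqr_ge0.
rewrite -esumZl ?sqr_ge0//.
apply: le_trans (esum_subset _ (@subsetT _ _)).
apply: le_esum => s /= qs; rewrite muleC lee_wpmul2l ?lee_fin//.
have qQ : (q%:E <= Q s)%E.
  by apply: le_trans (outlier_prob_le M omega eps k s); rewrite lee_fin.
by rewrite expr2 EFinM; apply: lee_pmul.
Qed.

Lemma nth_path_of (T : Type) (S : countType) (k : nat) (X : nat -> T -> S)
    (x0 : S) (w : T) (j : nat) : (j <= k)%N ->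
  nth x0 (path_of k X w) j = X j w.
Proof.
move=> jk; pose i := Ordinal (jk : (j < k.+1)%N).
by rewrite -[j]/(val i) -tnth_nth tnth_mktuple.
Qed.

Theorem theorem2p5 (R : realType) (S : countType) (M : markov_chain R S)
  (pi : S -> R) (omega : S -> R)
  (hstat : stationary M pi) (hrev : reversible M pi)
  (k m : nat) (hm : (1 <= m)%N)
  (eps alpha : R) (heps : 0 < eps) (halpha : 0 < alpha) (s0 : S)
  (d : measure_display) (T : measurableType d) (Pr : probability T R)
  (X : 'I_m -> nat -> T -> S)
  (htraj : forall i, trajectory_from M Pr k s0 (X i))
  (hindep : independent Pr (fun i => path_of k (X i)))
  (hs0 : ~ eps_alpha_outlier M pi omega k eps alpha s0) :
  (Pr [set w | forall i : 'I_m,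
         is_outlier eps k (fun j => omega (X i j w))]
   <= ((2 * eps / alpha) `^ (m%:R / 2))%:E)%E.
Proof.
(* As [m] is positive, there is a trajectory from [s0] that realizes the outlier probability. *)
have qE := outlier_probE omega eps (htraj (Ordinal hm)).
set q := outlier_prob M omega eps k s0 in qE.
have q0 : 0 <= q by rewrite -lee_fin qE low_prob_ge0.
have q2 : q ^+ 2 <= 2 * eps / alpha.
  by apply: (low_prob_sq_le hstat hrev) (esym qE) hs0.
pose A := [set l : k.+1.-tuple S |
  is_outlier eps k (fun j => omega (nth s0 l j))].
have pathA i : path_of k (X i) @^-1` A = outlier_event omega eps k (X i).
  apply/seteqP; split=> w; rewrite /A /outlier_event /is_outlier /=;
    congr (_%:R <= _); apply: eq_card => j; rewrite !inE !nth_path_of// -ltnS//.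
have := hindep [set: 'I_m]%SET (fun=> A).
rewrite [X in Pr X = _](_ : _ = [set w | forall i : 'I_m,
    is_outlier eps k (fun j => omega (X i j w))]); last first.
  apply/seteqP; split=> w /=.
    by move=> + i => /(_ i); rewrite pathA; apply; rewrite /= inE.
  by move=> Xw i _; rewrite pathA; exact: Xw.
move=> ->.
under eq_bigr do rewrite pathA (outlier_event_prob _ _ (htraj _)) -qE.
rewrite prodEFin prodr_const cardsT card_ord lee_fin.
(* Since [q] is nonnegative, its power can be rewritten through [q ^+ 2], to which the bound [q2]
   applies by monotonicity of real powers. *)
have -> : q ^+ m = (q ^+ 2) `^ (m%:R / 2).
  by rewrite -!powR_mulrn// -powRrM mulrC divfK.
apply: ge0_ler_powR => //; rewrite ?nnegrE ?sqr_ge0//.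
by apply: le_trans q2; exact: sqr_ge0.
Qed.
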